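(* Let $\varepsilon\in(0,1)$ be a constant and let $p=p(n)$ satisfy $n^{-1}\ll p\le 1-\varepsilon$. Let $X$ be the number of triangles in $G(n,p)$ and $\sigma^2=\mathrm{Var}(X)$ with $\sigma\ge 0$. Then with high probability $X$ is not contained in any fixed interval of length $o(\sigma)$; that is, for every sequence of (deterministic) intervals $I_n\subset\mathbb{R}$ whose lengths $|I_n|$ satisfy $|I_n|/\sigma\to 0$ as $n\to\infty$, we have $\mathbb{P}(X\in I_n)\to 0$ as $n\to\infty$.
   Context: $G(n,p)$ is the Erdős–Rényi random graph on the vertex set $[n]=\{1,\dots,n\}$, in which each edge of the complete graph $K_n$ is included independently with probability $p$. The number of triangles is the number of (unlabelled) copies of $K_3$ in the graph. The notation $n^{-1}\ll p$ means $np(n)\to\infty$ as $n\to\infty$. ''With high probability'' means with probability tending to $1$ as $n\to\infty$. *)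

(* Defs.v *)
From HB Require Import structures.
From mathcomp Require Import all_boot all_order all_algebra.
From mathcomp Require Import all_classical all_reals all_analysis.

Set Implicit Arguments.
Unset Strict Implicit.
Unset Printing Implicit Defensive.

Import Order.TTheory GRing.Theory Num.Theory.
Import numFieldNormedType.Exports.

Local Open Scope classical_set_scope.
Local Open Scope ring_scope.

(* The vertex set [n] is 'I_n; an edge of K_n is a 2-element subset of it. *)
Definition edge (n : nat) := {e : {set 'I_n} | #|e| == 2}.

(* A simple graph on 'I_n is identified with its set of edges. *)
Definition graph (n : nat) := {set edge n}.

HB.instance Definition _ n := Finite.on (graph n).
HB.instance Definition _ n := isPointed.Build (graph n) finset.set0.
HB.instance Definition _ n := @isMeasurable.Build default_measure_display
  (graph n) discrete_measurable discrete_measurable0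
  discrete_measurableC discrete_measurableU.

(* A copy of K_3 is given by its vertex set: three vertices spanning only edges
   of G. *)
Definition is_triangle n (G : graph n) (T : {set 'I_n}) : bool :=
  (#|T| == 3) && [forall e : edge n, (val e \subset T) ==> (e \in G)].

Definition triangles n (G : graph n) : nat :=
  #|[set T : {set 'I_n} | is_triangle G T]%SET|.

Section gnp.
Context {R : realType} (n : nat) (p : {i01 R}).

Definition gnp_pmf (G : graph n) : R :=
  \prod_(e : edge n) bernoulli_pmf p%:num (e \in G).

Lemma gnp_pmf_ge0 G : 0 <= gnp_pmf G.
Proof.
by apply: prodr_ge0 => e _; apply: bernoulli_pmf_ge0; rewrite ge0 le1.
Qed.

Lemma gnp_pmf1 : \sum_(G : graph n) gnp_pmf G = 1.
Proof.
transitivity (\prod_(e : edge n) (p%:num + (1 - p%:num))).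
  by rewrite bigA_distr; apply: eq_big => // G; rewrite inE.
by rewrite big1 // => e _; rewrite subrKC.
Qed.

Definition gnp (A : set (graph n)) : \bar R :=
  (\sum_(G \in A) (gnp_pmf G)%:E)%E.

Let gnp0 : gnp set0 = 0%E.
Proof. by rewrite /gnp fsbig_set0. Qed.

Let gnp_ge0 A : (0 <= gnp A)%E.
Proof.
rewrite /gnp fsbig_finite//= sumEFin lee_fin.
by apply: sumr_ge0 => G _; exact: gnp_pmf_ge0.
Qed.

Let gnp_sigma_additive : semi_sigma_additive gnp.
Proof.
move=> F mF tF mUF; rewrite /gnp.
apply: cvg_toP.
  apply: ereal_nondecreasing_is_cvgn => m k mk.
  by apply: lee_sum_nneg_natr => // i _ _; exact: gnp_ge0.
transitivity (\sum_(0 <= i <oo) (\esum_(G in F i) (gnp_pmf G)%:E))%E.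
  apply: eq_eseriesr => k _; rewrite esum_fset//= => G _.
  by rewrite lee_fin gnp_pmf_ge0.
rewrite -nneseries_sum_bigcup//=; last first.
  by move=> G; rewrite lee_fin gnp_pmf_ge0.
by rewrite esum_fset//= => G _; rewrite lee_fin gnp_pmf_ge0.
Qed.

HB.instance Definition _ := isMeasure.Build _ _ _ gnp
  gnp0 gnp_ge0 gnp_sigma_additive.

Let gnp_setT : gnp [set: _] = 1%E.
Proof.
rewrite /gnp fsbig_finite//= sumEFin -gnp_pmf1; congr EFin.
apply: perm_big; apply: uniq_perm => [||G].
- exact: finmap.fset_uniq.
- exact: index_enum_uniq.
- rewrite in_fset_set; last exact: finite_finset.
  by rewrite mem_index_enum; exact: mem_set.
Qed.

HB.instance Definition _ :=
  @Measure_isProbability.Build _ _ R gnp gnp_setT.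

End gnp.

Definition triangles_sigma {R : realType} (n : nat) (p : {i01 R}) : R :=
  Num.sqrt (fine 'V_(gnp p)[fun G : graph n => (triangles G)%:R]).

(* Main.v *)
Require Import Defs.
From mathcomp Require Import all_boot all_order all_algebra.
From mathcomp Require Import ring lra zify.

Import Order.TTheory GRing.Theory Num.Theory.
Local Open Scope ring_scope.

(* Let F count the members of a family of edge sets that lie in the random graph
   G, and let Y = \sum_j 1[A_j \subset G] for some sets A_j. Conditioning on
   A_j \subset G amounts to adding A_j to G, so for every f
     Cov(Y, f(F)) = \sum_j p^|A_j| E[f(F(A_j \cup G)) - f(F(G))].
   If F lies in [a, a + L] on an event B and f(x) is x - a truncated to
   [0, L + h], the right-hand side is at least
     \sum_j p^|A_j| E[1_B min(h, F(A_j \cup G) - F(G))],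
   whereas the left-hand side is at most sd(Y) (L + h). When F counts triangles,
   this bounds P(B), with A_j running over the triangles (h = 1) if
   n p^2 <= 1, and over the single edges (h small compared to sd(F), but large
   compared to n p^2) if n p^2 >= 1. The variances involved are bounded by the
   Efron-Stein inequality. Only the following features of the triangles of K_n,
   as sets of edges, matter: they have size 3, two of them share at most one edge,
   and each edge is in n - 2 of them. *)

(** * Random subsets of a finite set: expectation, covariance, Efron-Stein inequality *)

Section RandomSubset.
Context {R : realFieldType} {E : finType} (p : R).
Implicit Types (e : E) (A G H Z : {set E}) (F : {set E} -> R).

Definition weight G : R := \prod_e (if e \in G then p else 1 - p).

Definition expect F : R := \sum_G weight G * F G.

Definition var F : R := expect (fun G => (F G - expect F) ^+ 2).

(** The discrete derivative of [F] at [e]; its value is the same whether or not [e] lies in [G]. *)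
Definition diff e F G : R := F (e |: G) - F (G :\ e).

Lemma eq_expect F F' : F =1 F' -> expect F = expect F'.
Proof. by move=> FF'; apply: eq_bigr => G _; rewrite FF'. Qed.

Lemma expectD F F' : expect (fun G => F G + F' G) = expect F + expect F'.
Proof. by rewrite -big_split; apply: eq_bigr => G _; rewrite mulrDr. Qed.

Lemma expectZ c F : expect (fun G => c * F G) = c * expect F.
Proof. by rewrite mulr_sumr; apply: eq_bigr => G _; rewrite mulrCA. Qed.

Lemma expectB F F' : expect (fun G => F G - F' G) = expect F - expect F'.
Proof. by rewrite -sumrB; apply: eq_bigr => G _; rewrite mulrBr. Qed.

Lemma expect_sum (J : finType) (P : pred J) (F : J -> {set E} -> R) :
  expect (fun G => \sum_(j | P j) F j G) = \sum_(j | P j) expect (F j).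
Proof. by rewrite exchange_big; apply: eq_bigr => G _; rewrite mulr_sumr. Qed.

Lemma expect_cst c : expect (fun=> c) = c.
Proof.
rewrite /expect -mulr_suml [X in X * _](_ : _ = 1) ?mul1r//.
transitivity (\prod_(e : E) (p + (1 - p))).
  by rewrite bigA_distr; apply: eq_big => // G; rewrite inE.
by rewrite big1 // => e _; rewrite subrKC.
Qed.

Lemma varE F : var F = expect (fun G => F G ^+ 2) - expect F ^+ 2.
Proof.
rewrite /var; set m := expect F.
rewrite (eq_expect _ (fun G => F G ^+ 2 + ((- 2 * m) * F G + m ^+ 2))); last first.
  by move=> G; ring.
by rewrite 2!expectD expectZ expect_cst -/m; ring.
Qed.

Lemma expect_split e F :
  expect F = p * expect (fun G => F (e |: G))
           + (1 - p) * expect (fun G => F (G :\ e)).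
Proof.
pose W G := \prod_(f | f != e) (if f \in G then p else 1 - p).
(* Each [G] avoiding [e] is paired with [e |: G]; [W G] is the weight that the two share outside
   [e]. *)
have core F' : expect F' =
    \sum_(G : {set E} | e \notin G) W G * (p * F' (e |: G) + (1 - p) * F' G).
  rewrite /expect (bigID (fun G => e \in G))/=.
  rewrite (reindex_onto (fun G => e |: G) (fun G => G :\ e)) /=; last first.
    by move=> G; exact: setD1K.
  have -> : \sum_(G : {set E} | (e \in e |: G) && ((e |: G) :\ e == G))
       weight (e |: G) * F' (e |: G) =
     \sum_(G : {set E} | e \notin G) weight (e |: G) * F' (e |: G).
    apply: eq_bigl => G; rewrite setU11 /=.
    apply/eqP/idP => [<-|eG]; first by rewrite setD11.
    by rewrite setU1K.
  rewrite -big_split; apply: eq_bigr => G eG /=.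
  rewrite mulrDr !mulrA; congr (_ * _ + _ * _).
    rewrite /weight (bigD1 e)//= setU11 mulrC; congr (_ * _).
    by apply: eq_bigr => f fe; rewrite !inE (negbTE fe).
  by rewrite /weight (bigD1 e)//= (negbTE eG) mulrC.
rewrite 3!core !mulr_sumr -big_split; apply: eq_bigr => G eG /=.
rewrite !setUA setUid setU1K//.
have -> : G :\ e = G by apply/setDidPl; rewrite disjoint_sym disjoints1.
by ring.
Qed.

Lemma expect_mem e F :
  expect (fun G => (e \in G)%:R * F G) = p * expect (fun G => F (e |: G)).
Proof.
rewrite (expect_split e) [X in _ + _ * X](_ : _ = 0) ?mulr0 ?addr0.
  by congr (_ * _); apply: eq_expect => G; rewrite setU11 mul1r.
by rewrite -[RHS](expect_cst 0); apply: eq_expect => G; rewrite setD11 mul0r.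
Qed.

Lemma expect_notin e F :
  expect (fun G => (e \notin G)%:R * F G) = (1 - p) * expect (fun G => F (G :\ e)).
Proof.
rewrite (expect_split e) [X in _ * X + _](_ : _ = 0) ?mulr0 ?add0r.
  by congr (_ * _); apply: eq_expect => G; rewrite setD11 mul1r.
by rewrite -[RHS](expect_cst 0); apply: eq_expect => G; rewrite setU11 mul0r.
Qed.

(** By induction, [expect_mem] forces the elements of [A] into [G] one at a time; adding [e] to [G]
    does not affect whether [A :\ e] lies in [G]. *)
Lemma expect_subset A F :
  expect (fun G => (A \subset G)%:R * F G) =
  p ^+ #|A| * expect (fun G => F (A :|: G)).
Proof.
have [m] := ubnP #|A|; elim: m => // m IHm in A F *; rewrite ltnS => Am.
have [->|/set0Pn[e eA]] := eqVneq A finset.set0.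
  rewrite cards0 mul1r; apply: eq_expect => G.
  by rewrite sub0set mul1r set0U.
rewrite -{1 3}(setD1K eA) (cardsD1 e) eA add1n exprS -mulrA.
rewrite (eq_expect _ (fun G => (e \in G)%:R * ((A :\ e \subset G)%:R * F G))); last first.
  by move=> G; rewrite subUset sub1set mulrA -natrM mulnb.
rewrite expect_mem; congr (_ * _).
have sub G : (A :\ e \subset e |: G) = (A :\ e \subset G).
  apply/idP/idP => [/subsetP sAG|sAG]; last first.
    exact: subset_trans sAG (subsetUr _ _).
  by apply/subsetP => f fA; move: (sAG _ fA) (fA); rewrite !inE; case: eqP.
rewrite (eq_expect _ (fun G => (A :\ e \subset G)%:R * F (e |: G))); last first.
  by move=> G; rewrite sub.
rewrite IHm; last by apply: leq_trans Am; rewrite [leqRHS](cardsD1 e) eA.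
by congr (_ * _); apply: eq_expect => G; rewrite setUA.
Qed.

Lemma expect_subset1 A : expect (fun G => (A \subset G)%:R) = p ^+ #|A|.
Proof.
rewrite (eq_expect _ (fun G => (A \subset G)%:R * 1)).
  by rewrite expect_subset expect_cst mulr1.
by move=> G; rewrite mulr1.
Qed.

Lemma covariance_subset (J : finType) (A : J -> {set E}) F :
  let Y G := \sum_j (A j \subset G)%:R in
  expect (fun G => (Y G - expect Y) * F G) =
  \sum_j p ^+ #|A j| * expect (fun G => F (A j :|: G) - F G).
Proof.
move=> Y; rewrite (eq_expect _ (fun G => Y G * F G - expect Y * F G)); last first.
  by move=> G; ring.
rewrite expectB expectZ.
rewrite (eq_expect _ (fun G => \sum_j (A j \subset G)%:R * F G)); last first.
  by move=> G; rewrite mulr_suml.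
rewrite expect_sum /Y expect_sum mulr_suml -sumrB; apply: eq_bigr => j _.
by rewrite expect_subset expect_subset1 expectB mulrBr.
Qed.

Context (p_ge0 : 0 <= p) (p_le1 : p <= 1).

Lemma weight_ge0 G : 0 <= weight G.
Proof. by apply: prodr_ge0 => e _; case: ifP => _; rewrite ?subr_ge0. Qed.

Lemma le_expect F F' : (forall G, F G <= F' G) -> expect F <= expect F'.
Proof.
by move=> FF'; apply: ler_sum => G _; apply: ler_wpM2l => //; exact: weight_ge0.
Qed.

Lemma expect_ge0 F : (forall G, 0 <= F G) -> 0 <= expect F.
Proof. by move=> F0; rewrite -(expect_cst 0); exact: le_expect. Qed.

(** Integrating 2 s |x| <= x^2 + s^2 replaces Cauchy-Schwarz: no square root is taken in [R], and
    [s] may be any upper bound for the standard deviation. *)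
Lemma expect_dist_le F s : 0 < s -> var F <= s ^+ 2 ->
  expect (fun G => `|F G - expect F|) <= s.
Proof.
move=> s0 vs; set m := expect F.
have : expect (fun G => (2 * s) * `|F G - m|) <=
       expect (fun G => (F G - m) ^+ 2 + s ^+ 2).
  apply: le_expect => G; rewrite -(real_normK (num_real (F G - m))).
  by have := sqr_ge0 (`|F G - m| - s); rewrite sqrrB; lra.
rewrite expectZ expectD expect_cst -/(var F) => le2s.
rewrite -(ler_pM2l (x := 2 * s)); last lra.
by apply: le_trans le2s _; lra.
Qed.

(** Both sides are compared with the covariance of [Y] and a truncation of [F]. Outside [B],
    monotonicity of [F] makes every contribution nonnegative. *)
Lemma small_ball (J : finType) (A : J -> {set E}) F (B : {set {set E}}) L h s :
  let Y G := \sum_j (A j \subset G)%:R in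
  (forall G H, G \subset H -> F G <= F H) ->
  {in B &, forall G H, F G - F H <= L} ->
  0 <= L -> 0 <= h -> 0 < s -> var Y <= s ^+ 2 ->
  \sum_j p ^+ #|A j| *
     expect (fun G => (G \in B)%:R * Num.min h (F (A j :|: G) - F G))
  <= s * (L + h).
Proof.
move=> Y mF dB L0 h0 s0 vY.
have [->|/set0Pn[G0 G0B]] := eqVneq B finset.set0.
  rewrite big1 => [|j _]; first by rewrite mulr_ge0//; lra.
  rewrite (eq_expect _ (fun=> 0)) ?expect_cst ?mulr0// => G.
  by rewrite inE mul0r.
(* The minimum [a] of [F] on [B] serves as the left end of an interval [a, a + L] that contains the
   values of [F] on [B]. *)
pose G1 := [arg min_(G < G0 in B) F G]%O.
have [G1B leG1] : G1 \in B /\ {in B, forall G, F G1 <= F G}.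
  by rewrite /G1; case: arg_minP.
pose a := F G1.
pose f x := Num.min (Num.max 0 (x - a)) (L + h).
have f0 x : 0 <= f x <= L + h.
  by rewrite /f le_min le_max lexx /= ge_min lexx orbT andbT; lra.
apply: (@le_trans _ _ (expect (fun G => (Y G - expect Y) * f (F G)))).
  rewrite covariance_subset; apply: ler_sum => j _.
  apply: ler_wpM2l; first exact: exprn_ge0.
  apply: le_expect => G; have := mF _ _ (subsetUr (A j) G).
  (* On [B] the value F(G) - a is at most [L], so the cap L + h leaves room for an increase by
     [h]. *)
  move: (F (A j :|: G)) => y le_y; have [GB|_] := boolP (G \in B).
    have := leG1 _ GB; have := dB _ _ GB G1B; rewrite mul1r /f -/a => ? ?.
    rewrite !max_r ?subr_ge0 ?(le_trans _ le_y)// (@min_l _ _ (F G - a)); last lra.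
    by case: (leP h) => ?; case: (leP (y - a)) => ?; lra.
  rewrite mul0r subr_ge0 /f.
  by rewrite le_min2 ?le_max2 ?lerB.
apply: (@le_trans _ _ (expect (fun G => (L + h) * `|Y G - expect Y|))).
  apply: le_expect => G; rewrite mulrC; have /andP[f1 f2] := f0 (F G).
  apply: le_trans (ler_wpM2l f1 (ler_norm _)) _.
  exact: ler_wpM2r.
by rewrite expectZ mulrC; apply: ler_wpM2r; [lra|exact: expect_dist_le].
Qed.

(* The conditional expectation of [F] given all the elements of [G] but [e]. *)
Let avg e F G : R := p * F (e |: G) + (1 - p) * F (G :\ e).

Let expect_avg e F : expect (avg e F) = expect F.
Proof. by rewrite expectD !expectZ -expect_split. Qed.

(** Pointwise this is p x^2 + (1 - p) y^2 = (p x + (1 - p) y)^2 + p (1 - p) (x - y)^2. *)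
Let expect_sqr_avg e F : expect (fun G => F G ^+ 2) =
  expect (fun G => avg e F G ^+ 2) + p * (1 - p) * expect (fun G => diff e F G ^+ 2).
Proof.
rewrite (expect_split e) -!expectZ -!expectD; apply: eq_expect => G.
by rewrite /avg /diff; ring.
Qed.

Let expect_sqr_avg_le e F :
  expect (fun G => avg e F G ^+ 2) <= expect (fun G => F G ^+ 2).
Proof.
rewrite [leRHS](expect_sqr_avg e) lerDl; apply: mulr_ge0.
  by rewrite mulr_ge0 ?subr_ge0.
by apply: expect_ge0 => G; exact: sqr_ge0.
Qed.

Let diff_avg e f F G : e != f -> diff f (avg e F) G = avg e (diff f F) G.
Proof.
move=> ef; rewrite /diff /avg.
have -> : e |: (f |: G) = f |: (e |: G) by rewrite setUCA.
have -> : (e |: G) :\ f = e |: (G :\ f).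
  by apply/setP => x; rewrite !inE; case: (x =P e) => // ->; rewrite ef.
have -> : (f |: G) :\ e = f |: (G :\ e).
  by apply/setP => x; rewrite !inE; case: (x =P f) => // ->; rewrite eq_sym ef.
have -> : (G :\ e) :\ f = (G :\ f) :\ e by rewrite !setDDl setUC.
by ring.
Qed.

(** If e = f, the average no longer depends on [e] and its derivative vanishes. Otherwise the
    derivative commutes with averaging, which decreases second moments. *)
Let expect_sqr_diff_avg e f F :
  expect (fun G => diff f (avg e F) G ^+ 2) <= expect (fun G => diff f F G ^+ 2).
Proof.
have [<-|ef] := eqVneq e f.
  apply: le_expect => G; rewrite [X in X ^+ 2](_ : _ = 0) ?expr0n ?sqr_ge0//=.
  rewrite /diff /avg !setUA setUid setDDl setUid.
  have -> : e |: G :\ e = e |: G by apply/setP => g; rewrite !inE; case: eqP.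
  have -> : (e |: G) :\ e = G :\ e by apply/setP => g; rewrite !inE; case: eqP.
  by rewrite subrr.
apply: le_trans (expect_sqr_avg_le e _); apply: le_expect => G.
by rewrite diff_avg.
Qed.

(** Each averaging loses a second moment given by [expect_sqr_avg]. The loss can be charged to the
    original [F], since earlier averagings do not increase the derivatives in mean square. *)
Let foldl_avg s F : let F' := foldl (fun F e => avg e F) F s in
  expect F' = expect F /\
  expect (fun G => F G ^+ 2) <= expect (fun G => F' G ^+ 2) +
    p * (1 - p) * \sum_(e <- s) expect (fun G => diff e F G ^+ 2).
Proof.
elim: s F => [|e s IHs] F /=; first by rewrite big_nil mulr0 addr0.
have [-> le_s] := IHs (avg e F); split; first exact: expect_avg.
rewrite big_cons mulrDr (expect_sqr_avg e) addrCA [leRHS]addrC lerD2r.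
apply: le_trans le_s _; rewrite lerD2l ler_wpM2l ?mulr_ge0 ?subr_ge0//.
by apply: ler_sum => f _; exact: expect_sqr_diff_avg.
Qed.

Let foldl_avg_cst F G H :
  foldl (fun F e => avg e F) F (enum E) G = foldl (fun F e => avg e F) F (enum E) H.
Proof.
(* [Z] collects the elements that [F'] ignores; each averaging adds one to it, until it exhausts
   [E]. *)
have gen s Z F' : (forall G H, G :|: Z = H :|: Z -> F' G = F' H) ->
    forall G H, G :|: (Z :|: [set e in s]) = H :|: (Z :|: [set e in s]) ->
    foldl (fun F e => avg e F) F' s G = foldl (fun F e => avg e F) F' s H.
  elim: s Z F' => [|e s IHs] Z F' dF G1 G2 /=.
    rewrite [X in Z :|: X](_ : _ = finset.set0) ?setU0; first exact: dF.
    by apply/setP => e; rewrite !inE.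
  move=> eqG; apply: (IHs (e |: Z)) => [H1 H2 /setP eqH|].
    rewrite /avg; congr (_ * _ + _ * _); apply: dF; apply/setP => f;
    by have := eqH f; rewrite !inE; case: (f =P e) => //=; rewrite ?orbT.
  suff -> : e |: Z :|: [set e in s] = Z :|: [set f in e :: s] by [].
  by apply/setP => f; rewrite !inE -!orbA orbCA.
apply: (gen (enum E) finset.set0 F) => [G1 G2|]; first by rewrite !setU0 => ->.
by apply/setP => e; rewrite !inE mem_enum !orbT.
Qed.

(** After averaging over every element, [F] has become a constant equal to its mean, so the second
    moment that remains is the squared mean. *)
Lemma efron_stein F :
  var F <= p * (1 - p) * \sum_e expect (fun G => diff e F G ^+ 2).
Proof.
have [eE leE] := foldl_avg (enum E) F; move: eE leE (foldl_avg_cst F).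
set F' := foldl _ _ _.
rewrite big_enum /= => eE leE cstF; rewrite varE lerBlDl.
apply: le_trans leE _; rewrite lerD2r -eE.
have eF' : F' =1 fun=> F' finset.set0 by move=> G; exact: cstF.
rewrite (eq_expect _ _ eF') expect_cst -[leRHS]expect_cst.
by apply: le_expect => G; rewrite eF'.
Qed.

(** The square expands over pairs: equal indices give p^k, distinct ones p^(2k) by disjointness. The
    bound counts the diagonal in the second term too. *)
Lemma expect_sqr_sum_disjoint (J : finType) (P : pred J) (A : J -> {set E}) k :
  (forall j, P j -> #|A j| = k) ->
  (forall i j, P i -> P j -> i != j -> [disjoint A i & A j]) ->
  expect (fun G => (\sum_(j | P j) (A j \subset G)%:R) ^+ 2)
  <= #|P|%:R * p ^+ k + (#|P|%:R * p ^+ k) ^+ 2.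
Proof.
move=> cA dA.
rewrite (eq_expect _ (fun G =>
    \sum_(i | P i) \sum_(j | P j) (A i :|: A j \subset G)%:R)); last first.
  move=> G; rewrite expr2 mulr_suml; apply: eq_bigr => i _.
  by rewrite mulr_sumr; apply: eq_bigr => j _; rewrite subUset -natrM mulnb.
rewrite expect_sum.
apply: (@le_trans _ _ (\sum_(i | P i) (p ^+ k + \sum_(j | P j) p ^+ k * p ^+ k))).
  apply: ler_sum => i Pi; rewrite expect_sum (bigD1 i)//= setUid expect_subset1 cA//.
  rewrite lerD2l [leRHS](bigD1 i)//= -[leLHS]add0r lerD ?mulr_ge0 ?exprn_ge0//.
  apply: ler_sum => j /andP[Pj ji].
  rewrite expect_subset1 cardsU disjoint_setI0 ?dA// 1?eq_sym// cards0 subn0.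
  by rewrite !cA// exprD.
rewrite !sumr_const le_eqVlt; apply/orP; left; apply/eqP.
by ring.
Qed.

End RandomSubset.

(** * Counting the triples of a linear regular system inside a random set *)

Section LinearTripleSystem.
Context {R : realFieldType} {E I : finType} (T : I -> {set E}) (d : nat) (p : R).
Context (cardT : forall i, #|T i| = 3%N).
Context (linearT : forall i j, i != j -> (#|T i :&: T j| <= 1)%N).
Context (regularT : forall e, #|[pred i | e \in T i]| = d).
Context (p_ge0 : 0 <= p) (p_le1 : p <= 1).
Implicit Types (e f g : E) (i j : I) (G H : {set E}) (B : {set {set E}}).

Definition full G : R := \sum_i (T i \subset G)%:R.

(** These are the triples that a single further element would complete. *)
Definition twothirds G : R := \sum_i (#|T i :&: G| == 2%N)%:R.

Definition prob B : R := expect p (fun G => (G \in B)%:R).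

Let linearT_eq i j e f : e != f ->
  e \in T i -> f \in T i -> e \in T j -> f \in T j -> i = j.
Proof.
move=> ef ei fi ej fj; apply/eqP; case: (boolP (i == j)) => // /linearT.
rewrite leqNgt => /negP[]; apply: leq_trans (subset_leq_card (A := [set e; f]) _).
  by rewrite cards2 ef.
by apply/subsetP => g; rewrite !inE => /orP[] /eqP ->; apply/andP.
Qed.

Let card_setD1 i e : e \in T i -> #|T i :\ e| = 2%N.
Proof. by move=> eT; have := cardT i; rewrite (cardsD1 e) eT => -[]. Qed.

Lemma le_full G H : G \subset H -> full G <= full H.
Proof.
move=> GH; apply: ler_sum => i _; rewrite ler_nat.
by case: (boolP (T i \subset G)) => // /subset_trans ->.
Qed.

Lemma diff_full e G : diff e full G = \sum_(i | e \in T i) (T i :\ e \subset G)%:R.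
Proof.
rewrite /diff /full -sumrB [RHS]big_mkcond; apply: eq_bigr => i _.
rewrite -subDset subsetD1; case: ifPn => [_|eT]; first by rewrite andbF subr0.
rewrite andbT (_ : T i :\ e = T i) ?subrr//.
by apply/setDidPl; rewrite disjoint_sym disjoints1.
Qed.

Lemma full_add e G : full (e |: G) - full G = (e \notin G)%:R * diff e full G.
Proof.
have [eG|eG] /= := boolP (e \in G).
  by rewrite mul0r (_ : e |: G = G) ?subrr//; apply/setUidPr; rewrite sub1set.
rewrite mul1r /diff; congr (_ - full _).
by apply/esym/setDidPl; rewrite disjoint_sym disjoints1.
Qed.

(** Double counting: each triple with exactly one missing element is completed by adding that
    element and by no other single addition. *)
Lemma sum_full_add G : \sum_e (full (e |: G) - full G) = twothirds G.
Proof.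
under eq_bigr do rewrite full_add diff_full mulr_sumr big_mkcond /=.
rewrite exchange_big; apply: eq_bigr => i _; rewrite -big_mkcond /=.
have eq1 e : e \in T i ->
    (e \notin G)%:R * (T i :\ e \subset G)%:R = (T i :\: G == [set e])%:R :> R.
  move=> eT; rewrite -natrM mulnb; congr (_%:R); congr nat_of_bool.
  apply/andP/eqP => [[eG sG]|TG].
    apply/eqP; rewrite eqEsubset sub1set !inE eG eT andbT.
    by rewrite subDset setUC -subDset andbT.
  have : e \in T i :\: G by rewrite TG set11.
  rewrite inE => /andP[-> _]; split=> //.
  by rewrite subDset setUC -subDset TG.
rewrite (eq_bigr _ eq1) {eq1}.
have -> : (#|T i :&: G| == 2%N) = (#|T i :\: G| == 1%N).
  by have := cardT i; rewrite -(cardsID G (T i)) => /eqP;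
     case: (#|T i :&: G|) => [|[|[|[|]]]] //; case: (#|T i :\: G|) => [|[|[|[|]]]].
case: cards1P => [[e0 TG]|noe].
  have e0T : e0 \in T i.
    have : e0 \in T i :\: G by rewrite TG set11.
    by case/setDP.
  rewrite (bigD1 e0)//= TG eqxx big1 ?addr0// => e /andP[_ /negPf ee0].
  by rewrite (inj_eq set1_inj) eq_sym ee0.
by rewrite big1// => e _; case: eqP => // TG; case: noe; exists e.
Qed.

Lemma expect_full_add e :
  expect p (fun G => full (e |: G) - full G) = (1 - p) * (d%:R * p ^+ 2).
Proof.
rewrite (eq_expect _ _ _ (full_add e)) expect_notin; congr (_ * _).
rewrite (eq_expect _ _
  (fun G => \sum_(i | e \in T i) (T i :\ e \subset G)%:R)); last first.
  by move=> G; rewrite diff_full; apply: eq_bigr => i eT;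
     rewrite subsetD1 setD11 andbT.
rewrite expect_sum -(regularT e) mulr_natl -sumr_const; apply: eq_bigr => i eT.
by rewrite expect_subset1 card_setD1.
Qed.

Lemma expect_twothirds :
  expect p twothirds = #|E|%:R * ((1 - p) * (d%:R * p ^+ 2)).
Proof.
rewrite -(eq_expect _ _ _ sum_full_add) expect_sum.
by rewrite (eq_bigr _ (fun e _ => expect_full_add e)) sumr_const -[LHS]mulr_natl.
Qed.

Lemma expect_full : expect p full = #|I|%:R * p ^+ 3.
Proof.
rewrite expect_sum; under eq_bigr do rewrite expect_subset1 cardT.
by rewrite sumr_const mulr_natl.
Qed.

Lemma card_triples : (#|I| * 3 = #|E| * d)%N.
Proof.
transitivity (\sum_(i : I) \sum_(e : E | e \in T i) 1)%N.
  by rewrite -sum_nat_const; apply: eq_bigr => i _; rewrite sum1_card cardT.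
rewrite (exchange_big_dep xpredT)//= -sum_nat_const; apply: eq_bigr => e _.
by rewrite sum1_card regularT.
Qed.

(** By linearity the triples through [e] are disjoint apart from [e], so [expect_sqr_sum_disjoint]
    applies to the [d] remaining pairs. *)
Lemma expect_sqr_diff_full e : expect p (fun G => diff e full G ^+ 2) <=
  d%:R * p ^+ 2 + (d%:R * p ^+ 2) ^+ 2.
Proof.
under eq_expect do rewrite diff_full.
rewrite -(regularT e); apply: expect_sqr_sum_disjoint => // [i eT|i j ei ej ij].
  exact: card_setD1.
rewrite -setI_eq0; apply/eqP/setP => f; rewrite !inE.
apply/negP => /andP[/andP[fe fi] /andP[_ fj]].
by move: ij; rewrite (@linearT_eq i j e f) ?eqxx// eq_sym.
Qed.

(** Efron-Stein with a bound uniform in [e], the factor 1 - p being estimated by 1. *)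
Let var_le F c : (forall e, expect p (fun G => diff e F G ^+ 2) <= c) -> 0 <= c ->
  var p F <= p * #|E|%:R * c.
Proof.
move=> le_c c0; apply: le_trans (efron_stein _ _ _ F) _ => //.
rewrite -!mulrA; apply: ler_wpM2l => //.
apply: (@le_trans _ _ (\sum_e expect p (fun G => diff e F G ^+ 2))).
  apply: ler_piMl; last by rewrite gerBl.
  by apply: sumr_ge0 => e _; apply: expect_ge0 => // G; exact: sqr_ge0.
by rewrite mulr_natl -sumr_const; exact: ler_sum.
Qed.

Lemma var_full :
  var p full <= p * #|E|%:R * (d%:R * p ^+ 2 + (d%:R * p ^+ 2) ^+ 2).
Proof.
apply: var_le => [|]; first exact: expect_sqr_diff_full.
by rewrite addr_ge0 ?sqr_ge0 ?mulr_ge0 ?exprn_ge0.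
Qed.

(** If [k] of the other two elements of a triple through [e] lie in [G], the triple contributes
    [k = 1] - [k = 2], at most [k] in absolute value; the right-hand side adds up these [k]. *)
Lemma diff_twothirds_le e G : `|diff e twothirds G| <=
  \sum_(ig : I * E | (e \in T ig.1) && (ig.2 \in T ig.1 :\ e))
     ([set ig.2] \subset G)%:R.
Proof.
rewrite -(pair_big_dep (fun i => e \in T i) (fun i g => g \in T i :\ e)
   (fun _ g => ([set g] \subset G)%:R)) /=.
rewrite /diff /twothirds -sumrB [leRHS]big_mkcond.
apply: le_trans (ler_norm_sum _ _ _) _; apply: ler_sum => i _.
have -> : T i :&: (G :\ e) = (T i :\ e) :&: G by rewrite setIDA setIDAC.
case: ifPn => [eT|eT]; last first.
  have -> : T i :\ e = T i by apply/setDidPl; rewrite disjoint_sym disjoints1.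
  rewrite setIUr (_ : T i :&: [set e] = finset.set0) ?set0U ?subrr ?normr0//.
  by apply/eqP; rewrite setI_eq0 disjoint_sym disjoints1.
have -> : T i :&: (e |: G) = e |: (T i :\ e) :&: G.
  by apply/setP => f; rewrite !inE; case: (f =P e) => // ->; rewrite eT.
rewrite cardsU1 !inE eqxx /=.
have -> : \sum_(g in T i :\ e) ([set g] \subset G)%:R = #|(T i :\ e) :&: G|%:R :> R.
  rewrite -sum1_card natr_sum [RHS](eq_bigl (fun g => (g \in T i :\ e) && (g \in G))).
    by rewrite big_mkcondr; apply: eq_bigr => g _; rewrite sub1set; case: ifP.
  by move=> g; rewrite inE.
by case: (#|_|) => [|[|[|k]]];
   rewrite /= ?subrr ?subr0 ?sub0r ?normrN ?normr0 ?normr1 ?ler01 ?ler1n.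
Qed.

(** The 2d singletons in [diff_twothirds_le] are pairwise disjoint: by linearity [g] determines the
    triple through [e] and [g]. *)
Lemma var_twothirds :
  var p twothirds <= p * #|E|%:R * (2 * (d%:R * p) + (2 * (d%:R * p)) ^+ 2).
Proof.
have dp0 : 0 <= 2 * (d%:R * p) by rewrite !mulr_ge0.
apply: var_le => [e|]; last by rewrite addr_ge0 ?sqr_ge0.
pose P := [pred ig : I * E | (e \in T ig.1) && (ig.2 \in T ig.1 :\ e)].
have cardP : #|P| = (2 * d)%N.
  rewrite -sum1_card -(pair_big_dep (fun i => e \in T i) (fun i g => g \in T i :\ e)
   (fun _ g => 1%N)) /= -(regularT e) mulnC -sum_nat_const.
  by apply: eq_bigr => i eT; rewrite sum1_card card_setD1.
apply: le_trans (_ : expect p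
  (fun G => (\sum_(ig | P ig) ([set ig.2] \subset G)%:R) ^+ 2) <= _).
  apply: le_expect => // G; rewrite -(real_normK (num_real (diff _ _ _))).
  apply: lerXn2r; rewrite ?nnegrE ?sumr_ge0//.
  exact: diff_twothirds_le.
have := @expect_sqr_sum_disjoint _ _ p p_ge0 _ P (fun ig : I * E => [set ig.2]) 1.
rewrite expr1 cardP natrM -mulrA; apply => [ig _|[i g] [j h]]; first by rewrite cards1.
rewrite !inE /= => /andP[ei /andP[ge gi]] /andP[ej /andP[he hj]] neq.
rewrite disjoints1 inE; apply: contra neq => /eqP gh; rewrite -gh in he hj *.
by rewrite (@linearT_eq i j e g)// eq_sym.
Qed.

Lemma prob_ge0 B : 0 <= prob B.
Proof. by apply: expect_ge0 => // G; rewrite ler0n. Qed.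

(** Either [T i] already lies in [G], or adding it completes at least [T i] itself. *)
Let full_triangle i G :
  1 <= (T i \subset G)%:R + Num.min 1 (full (T i :|: G) - full G) :> R.
Proof.
case: (boolP (T i \subset G)) => [_|TG].
  by rewrite lerDl le_min ler01 subr_ge0 le_full ?subsetUr.
rewrite add0r le_min lexx lerBrDr /full [leRHS](bigD1 i)//= subsetUl.
rewrite [X in 1 + X](bigD1 i)//= (negPf TG) add0r lerD2l.
apply: ler_sum => j _; rewrite ler_nat.
by case: (boolP (T j \subset G)) => // /subset_trans ->//; exact: subsetUr.
Qed.

(** [small_ball] for the triples, with h = 1. On [B] each triple outside [G] contributes 1, and
    there are #|I| - full G of them. Replacing [full G] by its mean costs at most [s], which turns L
    + 1 into L + 2. *)
Lemma small_ball_triples B (L s : R) :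
  {in B &, forall G H, full G - full H <= L} -> 0 <= L ->
  0 < s -> var p full <= s ^+ 2 ->
  #|I|%:R * p ^+ 3 * (1 - p ^+ 3) * prob B <= s * (L + 2).
Proof.
move=> dB L0 s0 vs.
have := @small_ball _ _ p p_ge0 p_le1 _ T full B L 1 s le_full dB L0 ler01 s0 vs.
under eq_bigr do rewrite cardT.
rewrite -mulr_sumr -expect_sum => sb.
have le1 : expect p (fun G => #|I|%:R * (1 - p ^+ 3) * (G \in B)%:R) <= expect p (fun G =>
    (\sum_i (G \in B)%:R * Num.min 1 (full (T i :|: G) - full G)) +
      `|full G - expect p full|).
  apply: le_expect => // G.
  have [GB|_] := boolP (G \in B); last first.
    by rewrite mulr0 big1 ?add0r// => i _; rewrite mul0r.
  rewrite mulr1; under eq_bigr do rewrite mul1r.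
  have : #|I|%:R <= full G + \sum_i Num.min 1 (full (T i :|: G) - full G).
    rewrite /full -big_split -sum1_card natr_sum; apply: ler_sum => i _.
    exact: full_triangle.
  have := ler_norm (full G - expect p full); rewrite expect_full.
  by lra.
rewrite expectZ expectD -/(prob B) in le1.
have dev := expect_dist_le _ p_ge0 p_le1 _ _ s0 vs.
have p3 : p ^+ 3 <= 1 by rewrite exprn_ile1.
have p30 : 0 <= p ^+ 3 by rewrite exprn_ge0.
have := ler_wpM2l p30 le1.
have : p ^+ 3 * expect p (fun G => `|full G - expect p full|) <= 1 * s.
  by apply: ler_pM => //; apply: expect_ge0.
by lra.
Qed.

(** With zero variance, [small_ball_triples] would hold for the whole space and every s > 0; the
    chosen [s] makes it read c <= c / 2. *)
Lemma var_full_gt0 : (0 < #|I|)%N -> 0 < p -> p < 1 -> 0 < var p full.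
Proof.
move=> I0 p0 p1; rewrite lt_neqAle eq_sym; apply/andP; split; last first.
  by apply: expect_ge0 => // G; exact: sqr_ge0.
apply/eqP => v0.
have dB : {in [set: {set E}] &, forall G H, full G - full H <= #|I|%:R}.
  move=> G H _ _; apply: (@le_trans _ _ (full G)).
    by rewrite gerBl sumr_ge0.
  rewrite -sum1_card natr_sum; apply: ler_sum => i _.
  by case: (_ \subset _).
pose c := #|I|%:R * p ^+ 3 * (1 - p ^+ 3).
have c0 : 0 < c by rewrite !mulr_gt0 ?exprn_gt0 ?ltr0n// subr_gt0 exprn_ilt1.
pose s := c / (2 * (#|I|%:R + 2)).
have I2 : 0 < 2 * (#|I|%:R + 2) :> R by rewrite mulr_gt0// addr_gt0// ltr0n.
have s0 : 0 < s by rewrite divr_gt0.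
have := small_ball_triples setT #|I|%:R s dB (ler0n _ _) s0.
rewrite v0 sqr_ge0 => /(_ isT).
rewrite (_ : prob setT = 1); last first.
  by rewrite -[RHS](@expect_cst _ E p 1); apply: eq_expect => G; rewrite inE.
rewrite mulr1 -/c /s invfM mulrA mulfVK; last by rewrite gt_eqF// addr_gt0// ltr0n.
lra.
Qed.

(** [small_ball] for singletons, where [Y] is the size of [G]. The truncation is removed by x <=
    min(h, x) + x^2 / h, and the increments sum to [twothirds]. The terms on the right are the
    deviation of [twothirds], the cost of the truncation, and the covariance bound. *)
Lemma small_ball_edges B (L h m s : R) :
  {in B &, forall G H, full G - full H <= L} -> 0 <= L ->
  0 < h -> 0 < m -> p * #|E|%:R = m ^+ 2 -> 0 < s -> var p twothirds <= s ^+ 2 ->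
  m ^+ 2 * ((1 - p) * (d%:R * p ^+ 2)) * prob B <=
  p * s + m ^+ 2 * (d%:R * p ^+ 2 + (d%:R * p ^+ 2) ^+ 2) / h + m * (L + h).
Proof.
move=> dB L0 h0 m0 mE s0 vs; set D := d%:R * p ^+ 2.
have vY : var p (fun G => \sum_e ([set e] \subset G)%:R) <= m ^+ 2.
  rewrite -mE -[leRHS]mulr1; apply: var_le => // e.
  rewrite -[leRHS](@expect_cst _ E p 1); apply: le_expect => // G.
  rewrite /diff -sumrB (bigD1 e)//= !sub1set setU11 setD11 big1 ?subr0 ?addr0 ?expr1n//.
  by move=> f fe; rewrite !sub1set !inE (negPf fe) subrr.
have := @small_ball _ _ p p_ge0 p_le1 _ (fun e => [set e]) full B L h m
  le_full dB L0 (ltW h0) m0 vY.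
under eq_bigr do rewrite cards1 expr1.
rewrite -mulr_sumr -expect_sum => sb.
have le1 : expect p (fun G => #|E|%:R * ((1 - p) * D) * (G \in B)%:R) <=
  expect p (fun G =>
    ((\sum_e (G \in B)%:R * Num.min h (full (e |: G) - full G)) +
     h^-1 * \sum_e diff e full G ^+ 2) + `|twothirds G - expect p twothirds|).
  apply: le_expect => // G.
  have sq0 : 0 <= h^-1 * \sum_e diff e full G ^+ 2.
    by rewrite mulr_ge0 ?invr_ge0 ?(ltW h0)// sumr_ge0// => e _; exact: sqr_ge0.
  have [GB|_] := boolP (G \in B); last first.
    by rewrite mulr0 big1 ?add0r ?addr_ge0// => e _; rewrite mul0r.
  rewrite mulr1; under eq_bigr do rewrite mul1r.
  have : twothirds G <= \sum_e Num.min h (full (e |: G) - full G) +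
      h^-1 * \sum_e diff e full G ^+ 2.
    rewrite -sum_full_add mulr_sumr -big_split; apply: ler_sum => e _ /=.
    have dh : 0 <= h^-1 * diff e full G ^+ 2.
      by rewrite mulr_ge0 ?invr_ge0 ?(ltW h0)// sqr_ge0.
    rewrite full_add; case: (e \notin G); last first.
      by rewrite mul0r addr_ge0// le_min lexx ltW.
    rewrite mul1r; move: (diff e full G) dh => x dh.
    case: (leP h x) => [hx|_]; last by rewrite lerDl.
    (* [x <= h + x^2 / h] since [(x - h)^2 >= 0] and [x h >= 0] *)
    rewrite -(ler_pM2l h0) mulrDr mulVKf ?gt_eqF//.
    have := mulr_ge0 (ltW h0) (le_trans (ltW h0) hx).
    by have := sqr_ge0 (x - h); rewrite sqrrB; lra.
  have := ler_norm (expect p twothirds - twothirds G).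
  by rewrite distrC expect_twothirds -/D; lra.
rewrite expectZ !expectD expectZ -/(prob B) in le1.
have dev := expect_dist_le _ p_ge0 p_le1 _ _ s0 vs.
have sqle : expect p (fun G => \sum_e diff e full G ^+ 2) <= #|E|%:R * (D + D ^+ 2).
  rewrite expect_sum mulr_natl -sumr_const; apply: ler_sum => e _.
  exact: expect_sqr_diff_full.
have := ler_wpM2l p_ge0 le1.
have := ler_wpM2l p_ge0 dev.
have : p * (h^-1 * expect p (fun G => \sum_e diff e full G ^+ 2)) <=
    p * (h^-1 * (#|E|%:R * (D + D ^+ 2))).
  by rewrite ler_wpM2l// ler_wpM2l// invr_ge0 ltW.
by rewrite -mE; lra.
Qed.

End LinearTripleSystem.

(** The two regimes are separated by [D], the mean of [diff e (full T)]: triples are used if D <= 1,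
    single elements if D > 1. The parameter [K] bounds the relevant means from below and makes the
    error terms small. *)
Lemma small_ball_full {R : rcfType} {E I : finType} (T : I -> {set E}) (d : nat)
    (p eps eta K sigma : R) (B : {set {set E}}) :
  (forall i, #|T i| = 3%N) ->
  (forall i j, i != j -> (#|T i :&: T j| <= 1)%N) ->
  (forall e, #|[pred i | e \in T i]| = d) ->
  0 < p -> p <= 1 - eps -> 0 < eps -> 0 < eta -> 1 <= K ->
  K ^+ 2 <= p * #|E|%:R -> K <= #|I|%:R * p ^+ 3 -> 1 <= d%:R * p ->
  0 < sigma -> var p (full T) = sigma ^+ 2 ->
  {in B &, forall G H, full T G - full T H <= eta * sigma} ->
  eps * prob p B <= 12 * eta + 3 / K + 2 / (eta * K).
Proof.
move=> cardT linT regT p0 p1e eps0 eta0 K1 KE KI dp1 sg0 vs dB.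
have p_ge0 := ltW p0; have p_le1 : p <= 1 by lra.
have K0 : 0 < K by lra.
have P0 : 0 <= prob p B by exact: prob_ge0.
have L0 : 0 <= eta * sigma by rewrite mulr_ge0// ltW.
set D := d%:R * p ^+ 2.
have sg_le : sigma ^+ 2 <= p * #|E|%:R * (D + D ^+ 2).
  by rewrite -vs; exact: var_full.
have iK : 0 < K^-1 by rewrite invr_gt0.
have ieta : 0 < eta^-1 by rewrite invr_gt0.
rewrite invfM.
have [D1|D1] := leP D 1.
- have := @small_ball_triples _ _ _ T p cardT p_ge0 p_le1 B _ _ dB L0 sg0.
  rewrite vs lexx => /(_ isT).
  set N := #|I|%:R * p ^+ 3 in KI *.
  have N0 : 0 < N by lra.
  have NE : 3 * N = p * #|E|%:R * D.
    rewrite /N /D; have := card_triples T d cardT regT.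
    move/(congr1 (fun n => n%:R : R)); rewrite !natrM => ID.
    by rewrite (_ : 3 * _ = #|I|%:R * 3 * p ^+ 3); [rewrite ID|]; ring.
  have p3 : p ^+ 3 <= p by rewrite -[leRHS]expr1; exact: ler_wiXn2l.
  have -> : sigma * (eta * sigma + 2) = eta * sigma ^+ 2 + 2 * sigma by ring.
  have sg6 : sigma ^+ 2 <= 6 * N.
    apply: le_trans sg_le _; rewrite (_ : 6 * N = p * #|E|%:R * (D + D)); last first.
      by rewrite mulrDr -NE; ring.
    rewrite ler_wpM2l ?mulr_ge0// lerD2l expr2 ler_piMr//.
    by rewrite /D mulr_ge0// sqr_ge0.
  (* The linear term is absorbed into the quadratic one, at a cost 1 / eta that is small against N
     >= K. *)
  have amgm : 2 * sigma <= eta * sigma ^+ 2 + eta^-1.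
    rewrite -(ler_pM2l eta0) mulrDr mulfV ?gt_eqF//.
    by have := sqr_ge0 (eta * sigma - 1); rewrite sqrrB exprMn; lra.
  have le6 : eta * sigma ^+ 2 <= eta * (6 * N) by rewrite ler_pM2l.
  have NP : N * (eps * prob p B) <= N * (1 - p ^+ 3) * prob p B.
    by rewrite mulrA ler_wpM2r// ler_pM2l//; lra.
  move=> sb; rewrite -(ler_pM2l N0); apply: le_trans NP _.
  apply: le_trans sb _.
  have NK : 1 <= N * K^-1 by rewrite ler_pdivlMr ?mul1r.
  have : eta^-1 <= N * (eta^-1 * K^-1).
    by rewrite mulrCA ler_peMr// ltW.
  have : 0 <= N * K^-1 by lra.
  lra.
- have [m m0 mE] : exists2 m : R, 0 < m & m ^+ 2 = p * #|E|%:R.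
    have pE0 : 0 < p * #|E|%:R by apply: lt_le_trans KE; rewrite exprn_gt0.
    by exists (Num.sqrt (p * #|E|%:R)); rewrite ?sqrtr_gt0// sqr_sqrtr// ltW.
  have mK : K <= m.
    by rewrite -(@ler_pXn2r _ 2)// ?nnegrE ?(ltW m0) ?(ltW K0)// mE.
  have D0 : 0 < D by lra.
  have dp0 : 0 < d%:R * p by lra.
  (* For x = d p >= 1 one has 2 x + (2 x)^2 <= 9 x^2, whence the factor 3 in the bound for the
     deviation of [twothirds]. *)
  have s0 : 0 < 3 * m * (d%:R * p) by apply: mulr_gt0 => //; rewrite mulr_gt0.
  (* As sigma <= 2 m D, this [h] is comparable to the bound for L = eta sigma: the covariance term
     becomes 3 eta m^2 D, and the truncation costs at most 2 m D / eta. *)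
  have h0 : 0 < eta * m * D by apply: mulr_gt0 => //; apply: mulr_gt0.
  have vS : var p (twothirds T) <= (3 * m * (d%:R * p)) ^+ 2.
    apply: le_trans (@var_twothirds _ _ _ T d p cardT linT regT p_ge0 p_le1) _.
    rewrite -mE; move: (d%:R * p) dp1 => x x1.
    rewrite (_ : (3 * m * x) ^+ 2 = m ^+ 2 * (9 * x ^+ 2)); last by ring.
    rewrite ler_wpM2l ?sqr_ge0//.
    have : x <= x ^+ 2 by rewrite expr2 ler_peMr//; lra.
    by lra.
  have := @small_ball_edges _ _ _ T d p cardT linT regT p_ge0 p_le1 B _ _ m _ dB L0 h0 m0
    (esym mE) s0 vS.
  have sg2 : sigma <= 2 * m * D.
    have mD : 0 <= 2 * m * D by apply: mulr_ge0; [apply: mulr_ge0|]; lra.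
    rewrite -(@ler_pXn2r _ 2)// ?nnegrE ?(ltW sg0)//.
    apply: le_trans sg_le _; rewrite -mE.
    rewrite (_ : (2 * m * D) ^+ 2 = m ^+ 2 * (4 * D ^+ 2)); last by ring.
    rewrite ler_wpM2l ?sqr_ge0//.
    have : D <= D ^+ 2 by rewrite expr2 ler_peMr//; lra.
    by have := sqr_ge0 D; lra.
  rewrite -/D => sb.
  have mD0 : 0 < m ^+ 2 * D by rewrite mulr_gt0// exprn_gt0.
  rewrite -(ler_pM2l mD0).
  apply: (@le_trans _ _ (m ^+ 2 * ((1 - p) * D) * prob p B)).
    rewrite mulrA ler_wpM2r// -mulrA ler_pM2l ?exprn_gt0// mulrC ler_pM2r//; lra.
  apply: le_trans sb _.
  have e1 : p * (3 * m * (d%:R * p)) = 3 * (m * D) by rewrite /D; ring.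
  have e2 : m ^+ 2 * (D + D ^+ 2) / (eta * m * D) = eta^-1 * (m * (1 + D)).
    by field; rewrite ?gt_eqF.
  have e3 : m * (eta * sigma + eta * m * D) <= 3 * (eta * (m ^+ 2 * D)).
    have := ler_wpM2l (ltW (mulr_gt0 m0 eta0)) sg2; lra.
  have e4 : eta^-1 * (m * (1 + D)) <= 2 * (eta^-1 * (m * D)).
    by rewrite [leRHS]mulrCA ler_pM2l// [leRHS]mulrCA ler_pM2l//; lra.
  have mm : m * D <= m ^+ 2 * D * K^-1.
    rewrite ler_pdivlMr// expr2 mulrAC ler_pM2r// ler_pM2l//.
  have em : eta^-1 * (m * D) <= eta^-1 * (m ^+ 2 * D * K^-1).
    by rewrite ler_pM2l.
  have : 0 < eta * (m ^+ 2 * D) by exact: mulr_gt0 eta0 mD0.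
  rewrite e1 e2; lra.
Qed.

(** * The triangles of the complete graph as a linear triple system *)

Section TriangleSystem.
Context (n : nat).

Definition vertex_triple := {V : {set 'I_n} | #|V| == 3}.

Definition triangle_edges (V : vertex_triple) : {set edge n} :=
  [set e : edge n | val e \subset val V].

Lemma card_edge : #|{: edge n}| = 'C(n, 2).
Proof.
rewrite card_sig -[X in 'C(X, _)]card_ord -card_draws.
by apply: eq_card => e; rewrite !inE.
Qed.

Lemma card_vertex_triple : #|{: vertex_triple}| = 'C(n, 3).
Proof.
rewrite card_sig -[X in 'C(X, _)]card_ord -card_draws.
by apply: eq_card => e; rewrite !inE.
Qed.

Lemma card_triangle_edges V : #|triangle_edges V| = 3%N.
Proof.
rewrite -(card_imset _ val_inj) -[RHS]/('C(3, 2)).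
rewrite -[X in 'C(X, _)](eqP (valP V)) -cards_draws.
apply: eq_card => A; rewrite inE; apply/imsetP/andP => [[e]|[AV A2]].
  by rewrite inE => eV ->; split=> //; exact: (valP e).
by exists (Sub A A2) => //; rewrite inE.
Qed.

(** Two distinct edges cover at least three vertices, so a vertex triple containing both is their
    union. *)
Lemma triangle_edges_linear V W : V != W ->
  (#|triangle_edges V :&: triangle_edges W| <= 1)%N.
Proof.
apply: contraNT; rewrite -ltnNge => /card_gt1P[e [f []]].
rewrite !inE => /andP[eV eW] /andP[fV fW] ef.
have ef3 : (3 <= #|val e :|: val f|)%N.
  apply: (@leq_ltn_trans #|val e|); first by rewrite (eqP (valP e)).
  rewrite proper_card// properE subsetUl subUset subxx /=.
  apply: contra ef => fe; rewrite -val_eqE eq_sym eqEcard fe.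
  by rewrite (eqP (valP e)) (eqP (valP f)).
have eq_efU (U : vertex_triple) : val e \subset val U -> val f \subset val U ->
    val e :|: val f = val U.
  by move=> eU fU; apply/eqP; rewrite eqEcard subUset eU fU (eqP (valP U)).
by rewrite -val_eqE -(eq_efU V)// -(eq_efU W).
Qed.

(** A triple through [e] amounts to the choice of its third vertex outside [e]. *)
Lemma triangle_edges_regular e : #|[pred V | e \in triangle_edges V]| = (n - 2)%N.
Proof.
have cardU v : v \in ~: val e -> #|v |: val e| == 3.
  by rewrite inE cardsU1 (eqP (valP e)) => ->.
rewrite -(card_imset _ val_inj).
have -> : [set val V | V in [pred V | e \in triangle_edges V]] =
          [set v |: val e | v in ~: val e].
  apply/setP => A; apply/imsetP/imsetP => [[V]|[v ve ->]].
    rewrite !inE => eV ->.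
    have : #|val V :\: val e| == 1%N.
      by rewrite cardsD (setIidPr eV) (eqP (valP V)) (eqP (valP e)).
    move=> /cards1P[v Vv]; exists v.
      by have : v \in val V :\: val e; [rewrite Vv set11|rewrite !inE => /andP[]].
    rewrite -Vv; apply/setP => w; rewrite !inE.
    by case: (boolP (w \in val e)) => [/(subsetP eV) ->|_]; rewrite ?orbF.
  by exists (Sub (v |: val e) (cardU v ve)); rewrite ?inE //= subsetUr.
rewrite card_in_imset => [|v w]; first by rewrite cardsCs setCK card_ord (eqP (valP e)).
rewrite !inE => ve we /setP /(_ v); rewrite !inE eqxx (negPf ve) !orbF => /esym.
by move=> /eqP.
Qed.

Lemma trianglesE {R : realFieldType} (G : graph n) :
  (triangles G)%:R = full triangle_edges G :> R.
Proof.
rewrite /full -natr_sum; congr (_%:R).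
transitivity #|[set V | triangle_edges V \subset G]|; last first.
  by rewrite -sum1dep_card big_mkcond; apply: eq_bigr => V _; case: ifP.
rewrite -(card_imset _ val_inj); apply: eq_card => A; rewrite inE.
apply/andP/imsetP => [[A3 /forallP AG]|[V]].
  exists (Sub A A3) => //; rewrite inE; apply/subsetP => e; rewrite inE => eA.
  exact: implyP (AG e) eA.
rewrite inE => /subsetP VG ->; split; first exact: (valP V).
by apply/forallP => e; apply/implyP => eV; apply: VG; rewrite inE.
Qed.

End TriangleSystem.

From mathcomp Require Import all_classical all_reals all_analysis.

Import numFieldNormedType.Exports.

Local Open Scope classical_set_scope.
Local Open Scope ring_scope.

(** * Expectation, probability and variance under [gnp] as finite sums *)

Section GnpExpectation.
Context {R : realType} (n : nat) (p : {i01 R}).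

Lemma gnp_pmfE (G : graph n) : gnp_pmf p G = weight p%:num G.
Proof. by []. Qed.

(** The integral is split over singletons, on each of which the integrand is constant; nonnegativity
    permits this without a proof of integrability. *)
Lemma gnp_expectation (F : graph n -> R) : (forall G, 0 <= F G) ->
  'E_(gnp p)[F]%E = (expect p%:num F)%:E.
Proof.
move=> F0; rewrite unlock.
have -> : [set: graph n] = \big[setU/set0]_(G <- index_enum (graph n)) [set G].
  apply/seteqP; split=> // G _; rewrite -bigcup_seq; exists G => //=.
  exact: mem_index_enum.
rewrite (@ge0_integral_bigsetU _ _ R (gnp p) (graph n) (fun G => [set G])) /=; last first.
- by move=> G _; rewrite lee_fin.
- by move=> ? ? _.
- apply/trivIsetP => G H _ _ GH; rewrite -subset0 => x [/= -> /eqP].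
  by rewrite (negPf GH).
- exact: index_enum_uniq.
- by [].
rewrite /expect -sumEFin; apply: eq_bigr => G _.
rewrite (@eq_integral _ _ _ (gnp p) _ (cst (F G)%:E)); last first.
  by move=> H; rewrite inE /= => ->.
by rewrite integral_cst//= {1}/gnp fsbig_set1 -EFinM mulrC gnp_pmfE.
Qed.

Lemma gnp_prob (A : set (graph n)) :
  gnp p A = (prob p%:num [set G | G \in A]%SET)%:E.
Proof.
rewrite -[LHS](@expectation_indic _ _ _ (gnp p)) ?gnp_expectation//.
by congr EFin; apply: eq_expect => G; rewrite indicE inE.
Qed.

Lemma gnp_variance (F : graph n -> R) : (forall G, 0 <= F G) ->
  'V_(gnp p)[F]%E = (var p%:num F)%:E.
Proof.
move=> F0; rewrite /variance unlock (gnp_expectation F)//= gnp_expectation /= => [|G].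
  by congr EFin; apply: eq_expect => G; rewrite expr2.
exact: (sqr_ge0 (F G - _)).
Qed.

End GnpExpectation.

(** * Interval lengths and binomial coefficients *)

Lemma le_itv_measure {R : realType} (i : interval R) (x y : R) :
  x \in i -> y \in i -> x <= y -> ((y - x)%:E <= lebesgue_measure [set` i])%E.
Proof.
move=> xi yi; rewrite le_eqVlt => /orP[/eqP ->|xy].
  by rewrite subrr measure_ge0.
have -> : (y - x)%:E = lebesgue_measure [set` `[x, y]].
  by rewrite lebesgue_measure_itv /= lte_fin xy.
apply: le_measure; rewrite ?inE//= => z /=; rewrite in_itv /= => /andP[xz zy].
by apply: (interval_is_interval xi yi); rewrite xz.
Qed.

(** The constant 27 is attained at n = 3. *)
Lemma expn3_le_bin3 n : (2 < n)%N -> (n ^ 3 <= 27 * 'C(n, 3))%N.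
Proof.
case: n => [|[|[|m]]]// _; have := bin_ffact m.+3 3%N.
rewrite !ffactnSr ffactn0 mul1n !subSS !subn0 (_ : 3`! = 6%N)// => C3.
rewrite -(@leq_pmul2r 6%N)// -mulnA C3 expnSr.
have : (m.+3 ^ 2 * 6 <= 27 * (m.+2 * m.+1))%N by rewrite -mulnn; nia.
by nia.
Qed.

Lemma le_bin2 n : (2 < n)%N -> (n <= 'C(n, 2))%N.
Proof.
case: n => [|[|[|m]]]// _; have := bin_ffact m.+3 2%N.
by rewrite !ffactnSr ffactn0 (_ : 2`! = 2%N)//; nia.
Qed.


(** * The quantitative bound for triangles and the limit *)

Section Triangles.
Context {R : realType} (n : nat) (p : {i01 R}).

Let X : graph n -> R := full (triangle_edges n).

Lemma triangles_sigmaE : triangles_sigma n p = Num.sqrt (var p%:num X).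
Proof.
rewrite /triangles_sigma gnp_variance//=; congr (Num.sqrt (var _ _)).
by apply/funext => G; exact: trianglesE.
Qed.

(** The single condition 27 K^2 <= n p yields the three size conditions of [small_ball_full],
    through C(n,2) >= n, 27 C(n,3) >= n^3 and 3 (n - 2) >= n. *)
Lemma gnp_triangles_le (eps eta K : R) (i : interval R) :
  (2 < n)%N -> p%:num <= 1 - eps -> 0 < eps -> 0 < eta -> 1 <= K ->
  27 * K ^+ 2 <= n%:R * p%:num ->
  (lebesgue_measure [set` i] * (triangles_sigma n p)^-1%:E < eta%:E)%E ->
  eps * fine (gnp p [set G : graph n | (triangles G)%:R \in i])
  <= 12 * eta + 3 / K + 2 / (eta * K).
Proof.
move=> n2 p1 eps0 eta0 K1 npK; rewrite triangles_sigmaE gnp_prob /= => len_i.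
move: (p%:num) p1 npK len_i => q q1 npK len_i.
have K2 : K <= K ^+ 2 by rewrite expr2 ler_peMr//; lra.
have n0 : 0 < n%:R :> R by rewrite ltr0n; lia.
have q0 : 0 < q by rewrite -(pmulr_rgt0 _ n0); lra.
have I0 : (0 < #|{: vertex_triple n}|)%N by rewrite card_vertex_triple bin_gt0.
(* As [0^-1] is 0, the condition on the length would say nothing if the variance vanished. *)
have v0 : 0 < var q X.
  have [q_ge0 q_lt1] : 0 <= q /\ q < 1 by split; lra.
  by apply: var_full_gt0 => //; [exact: card_triangle_edges|exact: ltW].
have s0 : 0 < Num.sqrt (var q X) by rewrite sqrtr_gt0.
rewrite lte_pdivrMr// -EFinM in len_i.
apply: (@small_ball_full R (edge n) (vertex_triple n) (triangle_edges n) (n - 2)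
   q eps eta K (Num.sqrt (var q X))) => //.
- exact: card_triangle_edges.
- exact: triangle_edges_linear.
- exact: triangle_edges_regular.
- rewrite card_edge; apply: (@le_trans _ _ (q * n%:R)); first by rewrite mulrC; lra.
  by rewrite ler_pM2l// ler_nat le_bin2.
- rewrite card_vertex_triple.
  have : (n ^ 3)%:R * q ^+ 3 <= (27 * 'C(n, 3))%:R * q ^+ 3.
    by rewrite ler_pM2r ?exprn_gt0// ler_nat expn3_le_bin3.
  rewrite natrX natrM -exprMn.
  have : n%:R * q <= (n%:R * q) ^+ 3 by rewrite -[leLHS]expr1 ler_weXn2l//; lra.
  lra.
- have : n%:R * q <= (3 * (n - 2))%:R * q by rewrite ler_pM2r// ler_nat; lia.
  by rewrite natrM; lra.
- by rewrite sqr_sqrtr// ltW.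
- move=> G H; rewrite !inE /= !(@trianglesE n R) => Gi Hi.
  have [GH|/ltW GH] := leP (full (triangle_edges n) G) (full (triangle_edges n) H : R).
    by apply: (@le_trans _ _ 0); rewrite ?subr_le0// mulr_ge0// ltW.
  rewrite -lee_fin; apply: le_trans (ltW len_i); exact: le_itv_measure.
Qed.

End Triangles.

Theorem corollary1p3 (R : realType) (eps : R) (eps01 : 0 < eps < 1)
    (p : nat -> {i01 R})
    (np_pinfty : n%:R * (p n)%:num @[n --> \oo] --> +oo)
    (p_le : forall n : nat, (p n)%:num <= 1 - eps)
    (I : nat -> interval R)
    (length_I : (lebesgue_measure [set` I n] * (triangles_sigma n (p n))^-1%:E)%E
                  @[n --> \oo] --> 0%E) :
  gnp (p n) [set G : graph n | (triangles G)%:R \in I n] @[n --> \oo] --> 0%E.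
Proof.
have /andP[eps0 _] := eps01.
move/fine_cvgP : length_I => [fin_len /cvgr0Pnorm_lt len0].
apply/fine_cvgP; split; first by near=> n; rewrite gnp_prob.
apply/cvgr0Pnorm_lt => e e0.
(* The final bound is at most 12 eta + eta + eta, below 36 eta = eps e. *)
pose eta := eps * e / 36.
have eta0 : 0 < eta by rewrite !mulr_gt0.
(* The three summands ensure 1 <= K, 3 / K <= eta and 2 / (eta K) <= eta respectively. *)
pose K := 1 + 3 / eta + 2 / (eta * eta).
have iK0 : 0 <= 3 / eta by rewrite divr_ge0 ?ltW.
have iK1 : 0 <= 2 / (eta * eta) by rewrite divr_ge0 ?mulr_ge0 ?ltW.
have K1 : 1 <= K by rewrite /K; lra.
have K0 : 0 < K by lra.
near=> n.
have P0 : 0 <= fine (gnp (p n) [set G : graph n | (triangles G)%:R \in I n]).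
  by rewrite fine_ge0.
rewrite /= ger0_norm// -(ltr_pM2l eps0).
apply: (@le_lt_trans _ _ (12 * eta + 3 / K + 2 / (eta * K))).
  apply: gnp_triangles_le => //.
  - by near: n; exact: nbhs_infty_gt.
  - by near: n; move/cvgryPge : np_pinfty; exact.
  (* [fine] sends infinite values to 0, so finiteness is needed to recover the bound in the extended
     reals. *)
  - have finn : (lebesgue_measure [set` I n] * (triangles_sigma n (p n))^-1%:E)%E
      \is a fin_num by near: n.
    rewrite -(fineK finn) lte_fin; apply: le_lt_trans (ler_norm _) _.
    by near: n; exact: len0.
have K3 : 3 / K <= eta.
  rewrite ler_pdivrMr// -ler_pdivrMl// mulrC /K; lra.
have K2 : 2 / (eta * K) <= eta.
  rewrite ler_pdivrMr ?mulr_gt0// mulrA -ler_pdivrMl ?mulr_gt0// mulrC /K; lra.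
have -> : eps * e = 36 * eta by rewrite /eta [RHS]mulrC divfK.
lra.
Unshelve. all: by end_near.
Qed.
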